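(* Let $n\ge4$, $3\le k<n$, $\varphi\in S_n$, $I=\{1,\dots,n\}$ and $\mathcal M=\mathfrak{M}_{(n,\varphi)}$. The following conditions are equivalent: (i) there is $\mathcal M'$ which is a $k$-subpair of $\mathcal M$; (ii) there is $X\subset I$ such that $|X|=n-k$ and $\varphi(X)=X$. Furthermore, if (ii) holds then $\mathcal M'\cong\mathfrak{M}_{(k,\varphi|_{I\setminus X})}$.
   Context: A configuration is a pair $\langle S,\mathcal L\rangle$ of a point set $S$ and a family $\mathcal L$ of subsets of $S$ (blocks); $\cong$ means there is a bijection of the point sets under which a set of points is a block iff its image is a block. Let $n\ge 3$, $I=\{1,\dots,n\}$, $\varphi\in S_n$ a permutation of $I$, and let $A=\{a_1,\dots,a_n\}$, $B=\{b_1,\dots,b_n\}$ be disjoint $n$-element sets. For $i\in I$ put $A_i=(A\setminus\{a_i\})\cup\{b_i\}$ and $B_i=(B\setminus\{b_i\})\cup\{a_{\varphi(i)}\}$. The Möbius $n$-pair $\mathfrak{M}_{(n,\varphi)}$ is the configuration with point set $A\cup B$ and block set $\{A_i: i\in I\}\cup\{B_i: i\in I\}$. The same definition applies with any finite index set $J$, $|J|=k$, and permutation of $J$ in place of $I$, $\varphi$; in this sense $\mathfrak{M}_{(k,\varphi|_{I\setminus X})}$ is the Möbius $k$-pair of the permutation $\varphi|_{I\setminus X}$ of the $k$-set $I\setminus X$. For $n\ge4$ and $3\le k<n$, a $k$-subpair of $\mathcal M=\mathfrak{M}_{(n,\varphi)}$ is a (configuration isomorphic to a) Möbius $k$-pair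 $\mathcal M'$ obtained from $\mathcal M$ by deleting $2(n-k)$ points and $2(n-k)$ blocks: its points are the remaining points, and its blocks are the remaining blocks with the deleted points removed (each remaining block loses $n-k$ points). In the ''furthermore'' part, $\mathcal M'$ is the $k$-subpair obtained by deleting $a_i,b_i,A_i,B_i$ for $i\in X$.
   Formalization: For k=3, (i) also requires an isomorphism of M' onto a Möbius 3-pair taking the remaining points of A and B to its two halves; without this (i)⇒(ii) fails, e.g. n=6, φ=(1 2 3 4)(5 6). For k≥4 nothing is changed. *)

(* Defs.v *)
(* MathComp *)
From HB Require Import structures.
From mathcomp Require Import all_boot all_fingroup.

Set Implicit Arguments.
Unset Strict Implicit.
Unset Printing Implicit Defensive.

Record configuration := Configuration {
  point :> finType;
  blocks : {set {set point}}
}.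

Definition is_isom (M N : configuration) (f : M -> N) : Prop :=
  bijective f /\ forall s : {set M}, (s \in blocks M) = (f @: s \in blocks N).

Definition isomorphic (M N : configuration) : Prop :=
  exists f : M -> N, is_isom f.

(* The points of a Moebius pair over the index set J are the elements of J + J,
   with a_i = inl i and b_i = inr i. *)
Definition A_pts (J : finType) : {set J + J} := [set inl i | i : J].
Definition B_pts (J : finType) : {set J + J} := [set inr i | i : J].

Definition A_block (J : finType) (i : J) : {set J + J} :=
  inr i |: (A_pts J :\ inl i).
Definition B_block (J : finType) (phi : {perm J}) (i : J) : {set J + J} :=
  inl (phi i) |: (B_pts J :\ inr i).

Definition moebius (J : finType) (phi : {perm J}) : configuration :=
  @Configuration (J + J)%type
    ([set A_block i | i : J] :|: [set B_block phi i | i : J]).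

(* Delete the points in D and the blocks in E, and remove the points in D from
   the remaining blocks. *)
Definition delete (M : configuration) (D : {set M}) (E : {set {set M}}) :
    configuration :=
  @Configuration {x : M | x \notin D}
    [set [set y : {x : M | x \notin D} | val y \in s] | s : {set M} in blocks M :\: E].

(* Deleting D and E from the Moebius n-pair of phi yields a k-subpair. *)
Definition k_subpair (n k : nat) (phi : {perm 'I_n})
    (D : {set moebius phi}) (E : {set {set moebius phi}}) : Prop :=
  [/\ #|D| = 2 * (n - k),
      E \subset blocks (moebius phi),
      #|E| = 2 * (n - k),
      forall s, s \in blocks (moebius phi) :\: E -> #|s :&: D| = n - k
    & exists psi : {perm 'I_k}, isomorphic (delete D E) (moebius psi)].

Definition in_A (J : finType) (x : J + J) : bool := x \in A_pts J.

(* The two halves A and B of the k-pair are what remains of the halves of M.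
   For k >= 4 every k-subpair has this property; for k = 3 it does not follow
   from k_subpair. If phi = (0 1 2 3)(4 5) on 'I_6, deleting a_i and b_i for
   i < 3 and the blocks A_1, A_2, A_3, B_1, B_2, B_3 leaves a configuration
   isomorphic to a Moebius 3-pair, but only by isomorphisms mixing the halves,
   and phi has no invariant 3-subset. *)
Definition inherits_halves (n k : nat) (phi : {perm 'I_n})
    (D : {set moebius phi}) (E : {set {set moebius phi}}) : Prop :=
  exists (psi : {perm 'I_k}) (f : delete D E -> moebius psi),
    is_isom f /\ forall x, in_A (f x) = in_A (val x).

Lemma perm_notin_stable (T : finType) (phi : {perm T}) (X : {set T}) :
  phi @: X = X -> forall i : {i : T | i \notin X}, phi (val i) \notin X.
Proof.
move=> phiX [i /= iX]; apply: contra iX.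
by rewrite -{1}phiX mem_imset //; apply: perm_inj.
Qed.

Definition restr_fun (T : finType) (phi : {perm T}) (X : {set T})
    (phiX : phi @: X = X) (i : {i : T | i \notin X}) : {i : T | i \notin X} :=
  Sub (phi (val i)) (perm_notin_stable phiX i).

Lemma restr_fun_inj (T : finType) (phi : {perm T}) (X : {set T})
  (phiX : phi @: X = X) : injective (restr_fun phiX).
Proof. by move=> i j /(congr1 val) /= /perm_inj /val_inj. Qed.

(* The restriction of phi to the complement of an invariant set X. *)
Definition restr_compl (T : finType) (phi : {perm T}) (X : {set T})
    (phiX : phi @: X = X) : {perm {i : T | i \notin X}} :=
  perm (@restr_fun_inj T phi X phiX).

Definition pts_over (n : nat) (phi : {perm 'I_n}) (X : {set 'I_n}) :
    {set moebius phi} :=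
  [set inl i | i in X] :|: [set inr i | i in X].
Definition blocks_over (n : nat) (phi : {perm 'I_n}) (X : {set 'I_n}) :
    {set {set moebius phi}} :=
  [set A_block i | i in X] :|: [set B_block phi i | i in X].

(* Main.v *)
(* Let DA and DB be the index sets of the deleted points a_i and b_i, and RA
   and RB those of the remaining blocks A_i and B_i. Since a remaining block
   loses n - k points, |DA| + [i in DB] = (n - k) + [i in DA] for i in RA, and
   |DB| + [phi i in DA] = (n - k) + [i in DB] for i in RB. For k >= 4 two blocks
   of a Moebius k-pair share at most k - 2 points; applied to two remaining
   blocks of the same kind, this forces |DA| = |DB| = n - k and makes RA disjoint
   from DA and DB, RB from DB, and phi(RB) from DA. For k = 3 the same follows
   from the fact that a half is not a block. Since |RA| + |RB| >= 2k, all these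
   inclusions into complements are equalities, so DA = DB is phi-invariant. *)
Require Import Defs.
From mathcomp Require Import all_boot all_fingroup zify.

Set Implicit Arguments.
Unset Strict Implicit.
Unset Printing Implicit Defensive.

(** * Blocks of a Möbius pair, their number and their intersections *)

Section Blocks.
Variables (J : finType) (phi : {perm J}).

Lemma mem_A_pts (x : J + J) : (x \in A_pts J) = if x is inl _ then true else false.
Proof.
case: x => i; first by rewrite mem_imset // => ? ? [].
by apply/imsetP => -[].
Qed.

Lemma mem_B_pts (x : J + J) : (x \in B_pts J) = if x is inr _ then true else false.
Proof.
case: x => i; last by rewrite mem_imset // => ? ? [].
by apply/imsetP => -[].
Qed.

Lemma mem_A_block (i : J) (x : J + J) :
  (x \in A_block i) = match x with inl j => j != i | inr j => j == i end.
Proof. by rewrite !inE mem_A_pts; case: x => j //=; rewrite ?andbT ?andbF ?orbF. Qed.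

Lemma mem_B_block (i : J) (x : J + J) :
  (x \in B_block phi i) = match x with inl j => j == phi i | inr j => j != i end.
Proof. by rewrite !inE mem_B_pts; case: x => j //=; rewrite ?andbT ?andbF ?orbF. Qed.

Lemma A_block_inj : injective (@A_block J).
Proof. by move=> i j /setP/(_ (inr i)); rewrite !mem_A_block eqxx => /esym/eqP. Qed.

Lemma B_block_inj : injective (B_block phi).
Proof.
move=> i j /setP/(_ (inl (phi i))); rewrite !mem_B_block eqxx.
by move=> /esym/eqP/perm_inj.
Qed.

Lemma A_block_neq_B_block (i j : J) : 2 < #|J| -> A_block i <> B_block phi j.
Proof.
move=> J3 eAB.
(* With three indices there is an [l] other than [i] and [j]; then [b_l] lies in [B_j] but not in
   [A_i]. *)
have /card_gt0P[l] : 0 < #|~: [set i; j]|.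
  by move: (cardsC [set i; j]) J3; rewrite cards2; case: (i != j) => /=; lia.
rewrite !inE negb_or => /andP[li lj].
by move: eAB => /setP/(_ (inr l)); rewrite mem_A_block mem_B_block (negPf li) lj.
Qed.

Lemma blocksP (s : {set moebius phi}) :
  reflect (exists i, s = A_block i \/ s = B_block phi i) (s \in blocks (moebius phi)).
Proof.
rewrite inE; apply: (iffP orP) => [[]/imsetP[i _ ->]|[i [] ->]].
- by exists i; left.
- by exists i; right.
- by left; apply: imset_f.
- by right; apply: imset_f.
Qed.

Lemma card_A_B_blocks (X Y : {pred J}) : 2 < #|J| ->
  #|[set A_block i | i in X] :|: [set B_block phi i | i in Y]| = #|X| + #|Y|.
Proof.
move=> J3; rewrite cardsU [X in _ - X](_ : _ = 0).
  by rewrite subn0 !card_imset //; [apply: B_block_inj | apply: A_block_inj].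
apply/eqP; rewrite cards_eq0; apply/eqP/setP => s; rewrite !inE.
apply/negP => /andP[/imsetP[i _ ->] /imsetP[j _]].
exact: A_block_neq_B_block.
Qed.

Lemma card_blocks : 2 < #|J| -> #|blocks (moebius phi)| = 2 * #|J|.
Proof.
move=> J3; rewrite mul2n -addnn; exact: (card_A_B_blocks predT predT).
Qed.

Lemma card_sum_set (S : {set J + J}) : #|S| = #|inl @^-1: S| + #|inr @^-1: S|.
Proof.
by rewrite -!sum1_card big_sumType; congr (_ + _); apply: eq_bigl => j; rewrite inE.
Qed.

Lemma card_setC2 (i j : J) : i != j -> #|~: [set i; j]| = #|J| - 2.
Proof. by move=> ij; rewrite cardsCs setCK cards2 ij. Qed.

Lemma card_A_blockI (i j : J) : i != j -> #|A_block i :&: A_block j| = #|J| - 2.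
Proof.
move=> ij; rewrite card_sum_set -(card_setC2 ij).
have -> : inl @^-1: (A_block i :&: A_block j) = ~: [set i; j].
  by apply/setP => l; rewrite [LHS]inE in_setI !mem_A_block in_setC in_set2 negb_or.
have -> : inr @^-1: (A_block i :&: A_block j) = set0.
  apply/setP => l; rewrite [RHS]in_set0 [LHS]inE in_setI !mem_A_block.
  by apply/negP => /andP[/eqP-> ]; apply/negP.
by rewrite cards0 addn0.
Qed.

Lemma card_B_blockI (i j : J) :
  i != j -> #|B_block phi i :&: B_block phi j| = #|J| - 2.
Proof.
move=> ij; rewrite card_sum_set -(card_setC2 ij).
have -> : inr @^-1: (B_block phi i :&: B_block phi j) = ~: [set i; j].
  by apply/setP => l; rewrite [LHS]inE in_setI !mem_B_block in_setC in_set2 negb_or.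
have -> : inl @^-1: (B_block phi i :&: B_block phi j) = set0.
  apply/setP => l; rewrite [RHS]in_set0 [LHS]inE in_setI !mem_B_block.
  by apply/negP => /andP[/eqP-> ]; rewrite (inj_eq perm_inj); apply/negP.
by rewrite cards0.
Qed.

(** The only candidates for a common point are [a_(phi j)] and [b_i]: one from each half. *)
Lemma card_A_B_blockI (i j : J) : #|A_block i :&: B_block phi j| <= 2.
Proof.
rewrite card_sum_set -[2]/(1 + 1).
by apply: leq_add; [rewrite -(cards1 (phi j)) | rewrite -(cards1 i)];
  apply/subset_leq_card/subsetP => l; rewrite in_set in_setI mem_A_block mem_B_block;
  rewrite in_set1 => /andP[].
Qed.

(** Two blocks of the same kind meet in exactly [#|J| - 2] points. From four indices on, this number
    also dominates the bound 2 for blocks of different kinds; for three indices it is only 1. *)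
Lemma card_blockI (s t : {set moebius phi}) : 3 < #|J| ->
  s \in blocks (moebius phi) -> t \in blocks (moebius phi) -> s != t ->
  #|s :&: t| <= #|J| - 2.
Proof.
move=> J4 /blocksP[i si] /blocksP[j tj] st.
have J22 : 2 <= #|J| - 2 by lia.
case: si tj st => -> [] -> st.
- by rewrite card_A_blockI //; apply: contra st => /eqP->.
- exact: leq_trans (card_A_B_blockI _ _) J22.
- by rewrite setIC; apply: leq_trans (card_A_B_blockI _ _) J22.
- by rewrite card_B_blockI //; apply: contra st => /eqP->.
Qed.

Lemma exists_neq (i : J) : 1 < #|J| -> exists j, j != i.
Proof.
move=> J2; have /card_gt0P[j] : 0 < #|~: [set i]|.
  by rewrite cardsCs setCK cards1; lia.
by rewrite in_setC1; exists j.
Qed.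

(** Each [A_i] contains the foreign point [b_i], and each [B_i] has a single point in the half A.
    This and its companion for B replace the intersection bound when [k = 3]. *)
Lemma A_pts_not_block : 1 < #|J| -> A_pts J \notin blocks (moebius phi).
Proof.
move=> J2; apply/blocksP => -[i [] /setP].
  by move/(_ (inr i)); rewrite mem_A_pts mem_A_block eqxx.
have [j /negPf ji] := exists_neq (phi i) J2.
by move/(_ (inl j)); rewrite mem_A_pts mem_B_block ji.
Qed.

Lemma B_pts_not_block : 1 < #|J| -> B_pts J \notin blocks (moebius phi).
Proof.
move=> J2; apply/blocksP => -[i [] /setP].
  have [j /negPf ji] := exists_neq i J2.
  by move/(_ (inr j)); rewrite mem_B_pts mem_A_block ji.
by move/(_ (inl (phi i))); rewrite mem_B_pts mem_B_block eqxx.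
Qed.

End Blocks.

(** * Isomorphisms of configurations and renaming of indices *)

Section Isomorphisms.

(** A criterion by preimages, whose membership unfolds pointwise; for bijective [f] they invert
    direct images. *)
Lemma isom_preimset (M N : configuration) (f : M -> N) :
  bijective f -> blocks M = [set f @^-1: t | t : {set N} in blocks N] -> is_isom f.
Proof.
move=> f_bij eM; split=> // s; have [g fK gK] := f_bij.
have f_pre (u : {set M}) : f @^-1: (f @: u) = u.
  by apply/setP => x; rewrite inE mem_imset //; apply: can_inj fK.
rewrite eM; apply/imsetP/idP => [[t tN ->]|fsN]; last by exists (f @: s).
suff -> : f @: (f @^-1: t) = t by [].
apply/setP => y; rewrite -[y]gK mem_imset ?inE //; exact: can_inj fK.
Qed.

Lemma isom_inv (M N : configuration) (f : M -> N) (g : N -> M) :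
  is_isom f -> cancel f g -> cancel g f -> is_isom g.
Proof.
move=> [_ fb] fK gK; split; first by exists f.
move=> s; rewrite fb -imset_comp (_ : _ @: s = s) //.
rewrite -[RHS]imset_id; exact: eq_imset.
Qed.

Lemma isom_comp (M N P : configuration) (g : N -> P) (f : M -> N) :
  is_isom g -> is_isom f -> is_isom (g \o f).
Proof.
move=> [g_bij gb] [f_bij fb]; split; first exact: bij_comp.
by move=> s; rewrite fb gb imset_comp.
Qed.

Lemma card_isom_blocks (M N : configuration) (f : M -> N) :
  is_isom f -> #|blocks M| = #|blocks N|.
Proof.
move=> [[g fK gK] fb].
rewrite -(card_imset _ (imset_inj (can_inj fK))); apply: eq_card => t.
have -> : t = f @: (g @: t).
  by rewrite -imset_comp -[LHS]imset_id; apply: eq_imset => y /=; rewrite gK.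
by rewrite mem_imset ?fb //; apply/imset_inj/(can_inj fK).
Qed.

Lemma imset_sum_blocks (J : finType) (phi : {perm J}) (C : finType) (F : {set J + J} -> C) :
  [set F s | s in blocks (moebius phi)] =
  [set F (A_block i) | i : J] :|: [set F (B_block phi i) | i : J].
Proof. by rewrite imsetU -!imset_comp. Qed.

Definition sum_map (J K : Type) (h : J -> K) (x : J + J) : K + K :=
  match x with inl i => inl (h i) | inr i => inr (h i) end.

Lemma in_A_sum_map (J K : finType) (h : J -> K) (x : J + J) :
  in_A (sum_map h x) = in_A x.
Proof. by rewrite /in_A !mem_A_pts; case: x. Qed.

(** Conjugate permutations give isomorphic pairs: the preimage of the block with index [h i] is the
    block of the same kind with index [i]. *)
Lemma moebius_conj_isom (J K : finType) (phi : {perm J}) (psi : {perm K})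
    (h : J -> K) :
  bijective h -> (forall i, psi (h i) = h (phi i)) ->
  @is_isom (moebius phi) (moebius psi) (sum_map h).
Proof.
move=> [g hK gK] hphi; have h_inj := can_inj hK.
apply: isom_preimset.
  by exists (sum_map g) => -[] i /=; rewrite ?hK ?gK.
have preA i : sum_map h @^-1: A_block (h i) = A_block i.
  apply/setP => x; rewrite in_set !mem_A_block.
  by case: x => j /=; rewrite (inj_eq h_inj).
have preB i : sum_map h @^-1: B_block psi (h i) = B_block phi i.
  apply/setP => x; rewrite in_set !mem_B_block.
  by case: x => j /=; rewrite ?hphi (inj_eq h_inj).
rewrite imset_sum_blocks; congr (_ :|: _); apply/setP => s;
  apply/imsetP/imsetP => -[i _ ->].
- by exists (h i); rewrite ?preA.
- by exists (g i); rewrite // -[in LHS](gK i) preA.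
- by exists (h i); rewrite ?preB.
- by exists (g i); rewrite // -[in LHS](gK i) preB.
Qed.

(** Bridges the index type of the restricted permutation and ['I_k], which the definition of a
    subpair asks for; [psi] is [phi] conjugated by [enum_rank]. *)
Lemma moebius_ordinal (J : finType) (k : nat) (phi : {perm J}) : #|J| = k ->
  exists (psi : {perm 'I_k}) (f : moebius phi -> moebius psi),
    is_isom f /\ forall x, in_A (f x) = in_A x.
Proof.
move=> <-{k}.
have inj : injective (fun i : 'I_#|J| => enum_rank (phi (enum_val i))).
  by move=> i j /enum_rank_inj/perm_inj/enum_val_inj.
exists (perm inj), (sum_map enum_rank); split; last exact: in_A_sum_map.
by apply: moebius_conj_isom => [|i]; [apply: enum_rank_bij | rewrite permE enum_rankK].
Qed.

End Isomorphisms.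

(** * Deletion over an index set, and the subpair given by an invariant set *)

Section Subpair.
Variables (n : nat) (phi : {perm 'I_n}).

Lemma mem_pts_over (X : {set 'I_n}) (x : 'I_n + 'I_n) :
  (x \in pts_over phi X) = match x with inl i | inr i => i \in X end.
Proof.
rewrite inE; case: x => i; rewrite mem_imset; try by move=> ? ? [].
  by rewrite [X in _ || X](_ : _ = false) ?orbF //; apply/imsetP => -[].
by rewrite [X in X || _](_ : _ = false) //; apply/imsetP => -[].
Qed.

Lemma mem_A_blocks_over (X : {set 'I_n}) (i : 'I_n) : 2 < n ->
  (A_block i \in blocks_over phi X) = (i \in X).
Proof.
move=> n3; rewrite inE mem_imset; last exact: A_block_inj.
rewrite [X in _ || X](_ : _ = false) ?orbF //.
by apply/imsetP => -[j _]; apply: A_block_neq_B_block; rewrite card_ord.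
Qed.

Lemma mem_B_blocks_over (X : {set 'I_n}) (i : 'I_n) : 2 < n ->
  (B_block phi i \in blocks_over phi X) = (i \in X).
Proof.
move=> n3; rewrite inE mem_imset; last exact: B_block_inj.
rewrite [X in X || _](_ : _ = false) //.
by apply/imsetP => -[j _] /esym; apply: A_block_neq_B_block; rewrite card_ord.
Qed.

Section Invariant.
Variables (X : {set 'I_n}) (phiX : phi @: X = X).
Hypothesis n3 : 2 < n.

Local Notation J := {i : 'I_n | i \notin X}.
Local Notation rest := (delete (pts_over phi X) (blocks_over phi X)).

Lemma mem_perm_invariant i : (phi i \in X) = (i \in X).
Proof. by rewrite -[in LHS]phiX mem_imset //; apply: perm_inj. Qed.

Lemma inl_notin (j : J) : inl (val j) \notin pts_over phi X.
Proof. by rewrite mem_pts_over (valP j). Qed.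

Lemma inr_notin (j : J) : inr (val j) \notin pts_over phi X.
Proof. by rewrite mem_pts_over (valP j). Qed.

(** Directed towards the remaining points so that preimages of traces of blocks can be computed; the
    inverse is obtained by choice. *)
Definition to_rest (x : J + J) : rest :=
  match x with
  | inl j => Sub (inl (val j)) (inl_notin j)
  | inr j => Sub (inr (val j)) (inr_notin j)
  end.

Lemma val_to_rest x : val (to_rest x) = sum_map val x.
Proof. by case: x. Qed.

Lemma to_rest_bij : bijective to_rest.
Proof.
have inj : injective to_rest.
  move=> x y /(congr1 val); rewrite !val_to_rest.
  by case: x => i; case: y => j //= [] /val_inj->.
have surj (y : rest) : exists x, to_rest x == y.
  case: y => -[] i iX; have := iX; rewrite mem_pts_over => iX'.
    by exists (inl (Sub i iX')); rewrite -val_eqE /=.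
  by exists (inr (Sub i iX')); rewrite -val_eqE /=.
exists (fun y => xchoose (surj y)) => [x|y]; last exact/eqP/(xchooseP (surj y)).
by apply: inj; apply/eqP/(xchooseP (surj (to_rest x))).
Qed.

(** The trace of a remaining block with index [j] pulls back to the block of the same kind with
    index [j], because the restriction of [phi] agrees with [phi] on underlying indices. *)
Lemma to_rest_isom : @is_isom (moebius (restr_compl phiX)) rest to_rest.
Proof.
apply: isom_preimset; first exact: to_rest_bij.
have preA (j : J) :
    to_rest @^-1: [set y | val y \in A_block (val j)] = A_block j.
  apply/setP => x; rewrite in_set in_set val_to_rest !mem_A_block.
  by case: x => l /=; rewrite val_eqE.
have preB (j : J) :
    to_rest @^-1: [set y | val y \in B_block phi (val j)] =
    B_block (restr_compl phiX) j.
  apply/setP => x; rewrite in_set in_set val_to_rest !mem_B_block.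
  by case: x => l /=; rewrite ?permE -val_eqE.
apply/setP => s; apply/idP/imsetP => [/blocksP[j [] ->]|[t]].
- exists [set y | val y \in A_block (val j)]; last by rewrite preA.
  apply: imset_f; rewrite in_setD mem_A_blocks_over // (valP j).
  by apply/blocksP; exists (val j); left.
- exists [set y | val y \in B_block phi (val j)]; last by rewrite preB.
  apply: imset_f; rewrite in_setD mem_B_blocks_over // (valP j).
  by apply/blocksP; exists (val j); right.
- case/imsetP => u /setDP[/blocksP[i [] ->]].
    rewrite mem_A_blocks_over // => iX -> ->; apply/blocksP.
    by exists (Sub i iX); left; rewrite -preA.
  rewrite mem_B_blocks_over // => iX -> ->; apply/blocksP.
  by exists (Sub i iX); right; rewrite -preB.
Qed.

Lemma rest_isom : exists f : rest -> moebius (restr_compl phiX),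
  is_isom f /\ forall x, in_A (f x) = in_A (val x).
Proof.
have [g fK gK] := to_rest_bij; exists g; split.
  exact: isom_inv to_rest_isom fK gK.
by move=> x; rewrite -[in RHS](gK x) val_to_rest in_A_sum_map.
Qed.

Lemma invariant_inherits_halves (k : nat) : k <= n -> #|X| = n - k ->
  inherits_halves k (pts_over phi X) (blocks_over phi X).
Proof.
move=> kn cX; have cJ : #|{: J}| = k.
  have := cardsC X; rewrite card_sig cX card_ord => cn.
  rewrite (_ : #|_| = #|~: X|); first by lia.
  by apply: eq_card => i; rewrite !inE.
have [psi [h [h_iso hA]]] := moebius_ordinal (restr_compl phiX) cJ.
have [f [f_iso fA]] := rest_isom.
by exists psi, (h \o f); split=> [|x]; [apply: isom_comp | rewrite /= hA fA].
Qed.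

Lemma invariant_k_subpair (k : nat) : k <= n -> #|X| = n - k ->
  k_subpair k (pts_over phi X) (blocks_over phi X).
Proof.
move=> kn cX; split.
- rewrite card_sum_set -cX mul2n -addnn.
  by congr (_ + _); apply: eq_card => i; rewrite in_set mem_pts_over.
- by apply: setUSS; apply: imsetS; apply/subsetP.
- by rewrite card_A_B_blocks ?card_ord // cX mul2n addnn.
- move=> s /setDP[/blocksP[i [] ->]]; rewrite ?mem_A_blocks_over ?mem_B_blocks_over // => iX;
    rewrite card_sum_set -cX.
    (* [A_i] loses exactly the [a_j] with [j] in [X]: its point [b_i] survives since [i] is not in
       [X]. *)
    rewrite [X in _ + X](_ : _ = 0).
      rewrite addn0; apply: eq_card => j.
      rewrite in_set in_setI mem_A_block mem_pts_over andbC andb_idr //.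
      by move=> jX; apply: contra iX => /eqP<-.
    apply/eqP; rewrite cards_eq0; apply/eqP/setP => j.
    rewrite in_set0 in_set in_setI mem_A_block mem_pts_over.
    by apply/negP => /andP[/eqP->]; apply/negP.
  (* For [B_i] the point [a_(phi i)] survives; here invariance of [X] enters. *)
  rewrite [X in X + _](_ : _ = 0).
    rewrite add0n; apply: eq_card => j.
    rewrite in_set in_setI mem_B_block mem_pts_over andbC andb_idr //.
    by move=> jX; apply: contra iX => /eqP<-.
  apply/eqP; rewrite cards_eq0; apply/eqP/setP => j.
  rewrite in_set0 in_set in_setI mem_B_block mem_pts_over.
  by apply/negP => /andP[/eqP->]; rewrite mem_perm_invariant; apply/negP.
- have [psi [f [f_iso _]]] := invariant_inherits_halves kn cX.
  by exists psi, f.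
Qed.

End Invariant.

Lemma card_rest (M : configuration) (D S : {set M}) :
  #|[set y : {x : M | x \notin D} | val y \in S]| = #|S :\: D|.
Proof.
rewrite -(card_imset _ val_inj); apply: eq_card => x; rewrite in_setD.
apply/imsetP/andP => [[y yS ->]|[xD xS]]; first by rewrite (valP y); rewrite in_set in yS.
by exists (Sub x xD); rewrite ?in_set.
Qed.

(** * From a subpair to an invariant set *)

Section Converse.
Variables (k : nat) (D : {set moebius phi}) (E : {set {set moebius phi}}).
Hypotheses (n4 : 3 < n) (k3 : 2 < k) (kn : k < n) (DE : k_subpair k D E).

Local Notation DA := (inl @^-1: D : {set 'I_n}).
Local Notation DB := (inr @^-1: D : {set 'I_n}).
Local Notation RA := [set i | A_block i \notin E].
Local Notation RB := [set i | B_block phi i \notin E].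

Lemma card_remaining_blocks : #|blocks (moebius phi) :\: E| = 2 * k.
Proof.
have [_ sE cE _ _] := DE.
by rewrite cardsD (setIidPr sE) cE card_blocks card_ord //; lia.
Qed.

Lemma le_card_remaining : 2 * k <= #|RA| + #|RB|.
Proof.
rewrite -card_remaining_blocks -(card_A_B_blocks phi) ?card_ord; last by lia.
apply/subset_leq_card/subsetP => s /setDP[/blocksP[i [] ->]] iE; apply/setUP.
- by left; apply: imset_f; rewrite in_set.
- by right; apply: imset_f; rewrite in_set.
Qed.

(** The isomorphism sends the traces of [s] and [t] to two blocks of a Möbius k-pair, where the
    intersection bound applies provided that the traces differ. *)
Lemma card_rest_blockI (s t : {set moebius phi}) : 3 < k ->
  s \in blocks (moebius phi) :\: E -> t \in blocks (moebius phi) :\: E -> s != t ->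
  #|(s :&: t) :\: D| <= k - 2.
Proof.
move=> k4 sB tB st; have [_ _ _ _ [psi [f f_iso]]] := DE.
have [[g fK _] fb] := f_iso.
pose r (u : {set moebius phi}) := [set y : delete D E | val y \in u].
(* Distinct remaining blocks have distinct traces by counting: there are [2 * k] of the former, and
   the traces correspond to the [2 * k] blocks of a k-pair. *)
have r_inj : {in blocks (moebius phi) :\: E &, injective r}.
  apply/imset_injP/eqP; rewrite card_remaining_blocks.
  by rewrite [LHS](card_isom_blocks f_iso) card_blocks card_ord.
have rb u : u \in blocks (moebius phi) :\: E -> f @: r u \in blocks (moebius psi).
  by move=> uB; rewrite -fb; apply: imset_f.
have fI : f @: r (s :&: t) = (f @: r s) :&: (f @: r t).
  rewrite -imsetI; last exact: in2W (can_inj fK).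
  rewrite (_ : r (s :&: t) = r s :&: r t) //.
  by apply/setP => y; rewrite !inE.
rewrite -card_rest -(card_imset _ (can_inj fK)) -/(r _) fI.
apply: leq_trans (card_blockI _ (rb s sB) (rb t tB) _) _; rewrite ?card_ord //.
apply: contra st => /eqP/(imset_inj (can_inj fK)) rst.
by apply/eqP/r_inj.
Qed.

Lemma card_deleted : #|DA| + #|DB| = 2 * (n - k).
Proof. by have [<- _ _ _ _] := DE; rewrite card_sum_set. Qed.

(** The deleted points of [A_i] are the deleted [a_j] with [j] other than [i], together with [b_i]
    if it is deleted. The count is written without subtraction, with booleans as 0 or 1. *)
Lemma A_block_loss i : i \in RA -> #|DA| + (i \in DB) = n - k + (i \in DA).
Proof.
have [_ _ _ loss _] := DE; rewrite in_set => iE.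
have /loss : A_block i \in blocks (moebius phi) :\: E.
  by rewrite in_setD iE; apply/blocksP; exists i; left.
rewrite card_sum_set => <-; rewrite [in LHS](cardsD1 i).
rewrite (_ : inl @^-1: (_ :&: _) = DA :\ i); last first.
  by apply/setP => j; rewrite in_setD1 in_set in_setI mem_A_block in_set.
rewrite (_ : inr @^-1: (_ :&: _) = DB :&: [set i]); last first.
  by apply/setP => j; rewrite in_setI in_set1 in_set in_setI mem_A_block in_set andbC.
have -> : #|DB :&: [set i]| = (i \in DB).
  have := cardsD1 i DB; rewrite -(cardsID [set i] DB); lia.
lia.
Qed.

Lemma B_block_loss i : i \in RB -> #|DB| + (phi i \in DA) = n - k + (i \in DB).
Proof.
have [_ _ _ loss _] := DE; rewrite in_set => iE.
have /loss : B_block phi i \in blocks (moebius phi) :\: E.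
  by rewrite in_setD iE; apply/blocksP; exists i; right.
rewrite card_sum_set => <-; rewrite [in LHS](cardsD1 i).
rewrite (_ : inr @^-1: (_ :&: _) = DB :\ i); last first.
  by apply/setP => j; rewrite in_setD1 in_set in_setI mem_B_block in_set.
rewrite (_ : inl @^-1: (_ :&: _) = DA :&: [set phi i]); last first.
  by apply/setP => j; rewrite in_setI in_set1 in_set in_setI mem_B_block in_set andbC.
have -> : #|DA :&: [set phi i]| = (phi i \in DA).
  have := cardsD1 (phi i) DA; rewrite -(cardsID [set phi i] DA); lia.
lia.
Qed.

(** Removing [i] and [j] from the complement of [P] costs at most one element for each of them
    outside [P]; equality can fail when [i = j]. *)
Lemma card_compl_le (P : {set 'I_n}) i j :
  n <= #|P| + #|~: P :\: [set i; j]| + (i \notin P) + (j \notin P).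
Proof.
have := cardsC P; have := cardsD1 i (~: P); have := cardsD1 j (~: P :\ i).
by rewrite card_ord setDDl in_setD1 !in_setC; case: (j != i) => /=; lia.
Qed.

(** All surviving [a_l] with [l] other than [i] and [j] are common to the traces of [A_i] and [A_j],
    so there are at most [k - 2] of them. *)
Lemma A_pair i j : 3 < k -> i \in RA -> j \in RA -> i != j ->
  n <= #|DA| + (k - 2) + (i \notin DA) + (j \notin DA).
Proof.
move=> k4; rewrite [i \in _]in_set [j \in _]in_set => iE jE ij.
apply: leq_trans (card_compl_le DA i j) _; rewrite !leq_add2r leq_add2l.
apply: leq_trans (card_rest_blockI k4 _ _ (contra_neq (@A_block_inj _ i j) ij)).
- rewrite card_sum_set; apply: leq_trans (leq_addr _ _).
  apply/subset_leq_card/subsetP => l.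
  rewrite in_setD in_set2 negb_or in_setC in_set => /andP[/andP[li lj] lD].
  by rewrite in_set in_setD in_setI !mem_A_block li lj lD.
- by rewrite in_setD iE; apply/blocksP; exists i; left.
- by rewrite in_setD jE; apply/blocksP; exists j; left.
Qed.

Lemma B_pair i j : 3 < k -> i \in RB -> j \in RB -> i != j ->
  n <= #|DB| + (k - 2) + (i \notin DB) + (j \notin DB).
Proof.
move=> k4; rewrite [i \in _]in_set [j \in _]in_set => iE jE ij.
apply: leq_trans (card_compl_le DB i j) _; rewrite !leq_add2r leq_add2l.
apply: leq_trans (card_rest_blockI k4 _ _ (contra_neq (@B_block_inj _ phi i j) ij)).
- rewrite card_sum_set; apply: leq_trans (leq_addl _ _).
  apply/subset_leq_card/subsetP => l.
  rewrite in_setD in_set2 negb_or in_setC in_set => /andP[/andP[li lj] lD].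
  by rewrite in_set in_setD in_setI !mem_B_block li lj lD.
- by rewrite in_setD iE; apply/blocksP; exists i; right.
- by rewrite in_setD jE; apply/blocksP; exists j; right.
Qed.

Lemma exists_other (P : {set 'I_n}) i : 1 < #|P| -> exists2 j, j \in P & i != j.
Proof.
move=> P2; have /card_gt0P[j] : 0 < #|P :\ i| by have := cardsD1 i P; lia.
by rewrite in_setD1 eq_sym => /andP[]; exists j.
Qed.

(* Eliminating |DA| from [A_pair] with the loss formula for i gives
   [i in DB] + [j in DA] <= 0, and i and j can be exchanged. *)
Lemma A_remaining i : 3 < k -> 1 < #|RA| -> i \in RA ->
  [/\ #|DA| = n - k, i \notin DA & i \notin DB].
Proof.
move=> k4 RA2 iR; have [j jR ij] := exists_other i RA2.
have := A_pair k4 iR jR ij; have := A_block_loss iR; have := A_block_loss jR.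
by split; lia.
Qed.

(** The same elimination, now of |DB|, gives [phi i in DA] + [j in DB] <= 0. *)
Lemma B_remaining i : 3 < k -> 1 < #|RB| -> i \in RB ->
  [/\ #|DB| = n - k, i \notin DB & phi i \notin DA].
Proof.
move=> k4 RB2 iR; have [j jR ij] := exists_other i RB2.
have := B_pair k4 iR jR ij; have := B_block_loss iR; have := B_block_loss jR.
by split; lia.
Qed.

(** The common end of both cases. Disjointness is assumed only when two blocks of the kind remain,
    because the argument by intersections compares two of them. *)
Lemma invariant_of_disjoint :
  #|DA| = n - k -> #|DB| = n - k ->
  (1 < #|RA| -> {in RA, forall i, i \notin DA /\ i \notin DB}) ->
  (1 < #|RB| -> {in RB, forall i, i \notin DB /\ phi i \notin DA}) ->
  phi @: DA = DA.
Proof.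
move=> cA cB dA dB; have cR := le_card_remaining.
have cAC := cardsC DA; have cBC := cardsC DB; rewrite card_ord in cAC cBC.
have kA : #|~: DA| = k by lia.
have kB : #|~: DB| = k by lia.
(* With at most one block of the kind the bound is immediate; otherwise [RA] avoids [DA], whose
   complement has [k] elements. *)
have leA : #|RA| <= k.
  have [|RA2] := leqP #|RA| 1; first by lia.
  rewrite -[leqRHS]kA; apply/subset_leq_card/subsetP => i iR.
  by rewrite in_setC; have [] := dA RA2 i iR.
have leB : #|RB| <= k.
  have [|RB2] := leqP #|RB| 1; first by lia.
  rewrite -[leqRHS]kB; apply/subset_leq_card/subsetP => i iR.
  by rewrite in_setC; have [] := dB RB2 i iR.
(* Both bounds are now attained, so at least three blocks of each kind remain and the conditions can
   be discharged. *)
have {}dA := dA ltac:(lia); have {}dB := dB ltac:(lia).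
have eA : RA = ~: DA.
  apply/eqP; rewrite eqEcard kA; apply/andP; split; last by lia.
  by apply/subsetP => i /dA[]; rewrite in_setC.
have eAB : RA = ~: DB.
  apply/eqP; rewrite eqEcard kB; apply/andP; split; last by lia.
  by apply/subsetP => i /dA[_]; rewrite in_setC.
have eB : RB = ~: DB.
  apply/eqP; rewrite eqEcard kB; apply/andP; split; last by lia.
  by apply/subsetP => i /dB[]; rewrite in_setC.
(* [RB] equals the complement of [DA] through [DB] and [RA], and [phi] maps [RB] off [DA]. Equal
   cardinality gives invariance of the complement, hence of [DA]. *)
have sC : phi @: (~: DA) \subset ~: DA.
  by apply/subsetP => _ /imsetP[i iA ->]; rewrite in_setC;
     move: iA; rewrite -eA eAB -eB => /dB[].
have /eqP eC : phi @: (~: DA) == ~: DA.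
  by rewrite eqEcard sC card_imset ?leqnn //; apply: perm_inj.
apply/eqP; rewrite eqEcard card_imset ?leqnn ?andbT; last exact: perm_inj.
apply/subsetP => _ /imsetP[i iA ->]; apply/negPn/negP => piA.
have : phi i \in phi @: (~: DA) by rewrite eC in_setC.
by rewrite mem_imset ?in_setC ?iA //; apply: perm_inj.
Qed.

Lemma invariant_of_k_gt3 : 3 < k -> #|DA| = n - k /\ phi @: DA = DA.
Proof.
move=> k4; have cR := le_card_remaining; have cD := card_deleted.
have cA : #|DA| = n - k.
  (* At least one kind has two remaining blocks; it determines the size of one of [DA], [DB], and
     the total [2 * (n - k)] determines the other. *)
  have [RA2|RA1] := ltnP 1 #|RA|.
    have /card_gt0P[i iR] : 0 < #|RA| by lia.
    by have [] := A_remaining k4 RA2 iR.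
  have RB2 : 1 < #|RB| by lia.
  have /card_gt0P[i iR] : 0 < #|RB| by lia.
  by have [cB _ _] := B_remaining k4 RB2 iR; lia.
split=> //; apply: invariant_of_disjoint => //; first by lia.
- by move=> RA2 i iR; have [] := A_remaining k4 RA2 iR.
- by move=> RB2 i iR; have [] := B_remaining k4 RB2 iR.
Qed.

(** Since [f] respects the halves, [k] points of A survive, which fixes |DA| and |DB|. The loss
    formulas then say that [a_i] and [b_i] are deleted together for [i] in [RA], and likewise [b_i]
    and [a_(phi i)] for [i] in [RB]. *)
Lemma invariant_of_halves : inherits_halves k D E -> #|DA| = n - k /\ phi @: DA = DA.
Proof.
move=> [psi [f [[[g fK gK] fb] fA]]]; have cD := card_deleted.
pose r (u : {set moebius phi}) := [set y : delete D E | val y \in u].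
have fr (S : {set 'I_n + 'I_n}) (T : {set 'I_k + 'I_k}) :
    (forall x, (f x \in T) = (val x \in S)) -> f @: r S = T.
  move=> fS; apply/setP => y; rewrite -[y]gK mem_imset; last exact: can_inj fK.
  by rewrite fS in_set.
have B_ptsE (J : finType) (x : J + J) : (x \in B_pts J) = ~~ in_A x.
  by rewrite /in_A mem_A_pts mem_B_pts; case: x.
have frA : f @: r (A_pts 'I_n) = A_pts 'I_k by apply: fr => x; apply: fA.
have frB : f @: r (B_pts 'I_n) = B_pts 'I_k.
  by apply: fr => x; rewrite !B_ptsE; congr (~~ _); apply: fA.
have cA : #|DA| = n - k.
  have : #|r (A_pts 'I_n)| = k.
    rewrite -(card_imset _ (can_inj fK)) frA card_imset ?card_ord //.
    by move=> i j [].
  rewrite card_rest card_sum_set => <-.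
  rewrite (_ : inl @^-1: (_ :\: _) = ~: DA); last first.
    by apply/setP => i; rewrite in_set in_setD mem_A_pts andbT in_setC in_set.
  rewrite (_ : inr @^-1: (_ :\: _) = set0); last first.
    by apply/setP => i; rewrite in_set in_setD mem_A_pts andbF in_set0.
  by have := cardsC DA; rewrite cards0 card_ord; lia.
have k2 : 1 < #|'I_k| by rewrite card_ord; lia.
have rb s : s \in blocks (moebius phi) -> s \notin E ->
    f @: r s \in blocks (moebius psi).
  by move=> sB sE; rewrite -fb; apply: imset_f; rewrite in_setD sE.
split=> //; apply: invariant_of_disjoint => //; first by lia.
- move=> _ i iR; have iAB : (i \in DB) = (i \in DA).
    by have := A_block_loss iR; lia.
  rewrite iAB; suff iA : i \notin DA by [].
  (* If [a_i] and [b_i] were both deleted, [A_i] and A would have the same trace, and the half A of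
     the k-pair would be a block. *)
  apply: contra (A_pts_not_block psi k2) => iA.
  have iB : i \in DB by rewrite iAB.
  rewrite -frA (_ : r _ = r (A_block i)).
    by apply: rb; [apply/blocksP; exists i; left | rewrite in_set in iR].
  apply/setP => y; rewrite [LHS]in_set [RHS]in_set mem_A_pts mem_A_block.
  rewrite in_set in iA; rewrite in_set in iB.
  case: y => -[] j jD /=; apply/esym.
    by apply: contra jD => /eqP->.
  by apply/negbTE; apply: contra jD => /eqP->.
- move=> _ i iR; have iBA : (phi i \in DA) = (i \in DB).
    by have := B_block_loss iR; lia.
  rewrite iBA; suff iB : i \notin DB by [].
  (* Likewise, deleting [b_i] and [a_(phi i)] would give [B_i] the trace of B. *)
  apply: contra (B_pts_not_block psi k2) => iB.
  have iA : phi i \in DA by rewrite iBA.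
  rewrite -frB (_ : r _ = r (B_block phi i)).
    by apply: rb; [apply/blocksP; exists i; right | rewrite in_set in iR].
  apply/setP => y; rewrite [LHS]in_set [RHS]in_set mem_B_pts mem_B_block.
  rewrite in_set in iA; rewrite in_set in iB.
  case: y => -[] j jD /=; apply/esym.
    by apply/negbTE; apply: contra jD => /eqP->.
  by apply: contra jD => /eqP->.
Qed.

End Converse.

End Subpair.

(** * The equivalence and the form of the subpair *)

Theorem proposition2p7 (n k : nat) (phi : {perm 'I_n}) :
  4 <= n -> 3 <= k -> k < n ->
  ((exists (D : {set moebius phi}) (E : {set {set moebius phi}}),
      k_subpair k D E /\ (k = 3 -> inherits_halves k D E))
   <-> (exists X : {set 'I_n}, #|X| = n - k /\ phi @: X = X))
  /\ (forall (X : {set 'I_n}) (phiX : phi @: X = X), #|X| = n - k ->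
      k_subpair k (pts_over phi X) (blocks_over phi X) /\
      isomorphic (delete (pts_over phi X) (blocks_over phi X))
                 (moebius (restr_compl phiX))).
Proof.
move=> n4 k3 kn; have n3 : 2 < n by lia.
split; last first.
  move=> X phiX cX; split; first exact: invariant_k_subpair (ltnW kn) cX.
  by have [f [f_iso _]] := rest_isom phiX n3; exists f.
split=> [[D [E [DE halves]]]|[X [cX phiX]]].
  (* In both cases the invariant set consists of the indices of the deleted [a_i]. *)
  have [k4|/negPf k_not_gt3] := boolP (3 < k).
    by exists (inl @^-1: D); apply: invariant_of_k_gt3 DE k4.
  have k_eq3 : k = 3 by lia.
  by exists (inl @^-1: D); apply: invariant_of_halves DE (halves k_eq3).
exists (pts_over phi X), (blocks_over phi X); split.
  exact: invariant_k_subpair (ltnW kn) cX.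
by move=> _; apply: invariant_inherits_halves (ltnW kn) cX.
Qed.
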